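(* Let $R$ be any commutative ring with unity $1 \neq 0$ and let $n \ge 2$ be an integer. Then $LO_n(1,R)=RO_n(1,R) = O_n(R)$.
   Context: For $k\in R$, $LO_n(k,R)=\{A\in M_n(R) : A^TA=kI_n\}$ and $RO_n(k,R)=\{A\in M_n(R) : AA^T=kI_n\}$, where $M_n(R)$ is the ring of $n\times n$ matrices over $R$ and $I_n$ its identity. $O_n(R)=\{A\in M_n(R): A^TA=AA^T=I_n\}$ is the orthogonal group of degree $n$. *)

(* Defs.v *)
From HB Require Import structures.
From mathcomp Require Import all_boot all_order all_algebra.
From mathcomp Require Import classical_sets.

Set Implicit Arguments.
Unset Strict Implicit.
Unset Printing Implicit Defensive.

Import GRing.Theory.
Local Open Scope ring_scope.
Local Open Scope classical_set_scope.

Definition LO (R : comNzRingType) (n : nat) (k : R) : set 'M[R]_n :=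
  [set A : 'M[R]_n | A^T *m A = k%:M].

Definition RO (R : comNzRingType) (n : nat) (k : R) : set 'M[R]_n :=
  [set A : 'M[R]_n | A *m A^T = k%:M].

Definition orthogonal_group (R : comNzRingType) (n : nat) : set 'M[R]_n :=
  [set A : 'M[R]_n | A^T *m A = 1%:M /\ A *m A^T = 1%:M].

Arguments LO {R} n k.
Arguments RO {R} n k.
Arguments orthogonal_group R n : clear implicits.

(* Main.v *)
Require Import Defs.
From HB Require Import structures.
From mathcomp Require Import all_boot all_order all_algebra.
From mathcomp Require Import classical_sets.

Import GRing.Theory.
Local Open Scope ring_scope.

Theorem corollary3p17 (R : comNzRingType) (n : nat) (hn : (2 <= n)%N) :
  LO n (1 : R) = RO n (1 : R) /\ RO n (1 : R) = orthogonal_group R n.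
Proof.
split; apply/seteqP; split=> A /=.
(* Over a commutative ring, a one-sided inverse of a square matrix is two-sided: if
   [A^T *m A = 1%:M], taking determinants makes [\det A] a unit, so the adjugate yields a two-sided
   inverse of [A], which must be [A^T]. This exchange of factors, [mulmx1C], carries every inclusion
   except the projection out of [orthogonal_group]. *)
- exact: mulmx1C.
- exact: mulmx1C.
- by move=> AAt; split; first exact: mulmx1C.
- by case.
Qed.
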